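(* Let $K$ be a suitable convolution kernel on $\mathbb{R}^d$, let $E_0\subseteq\mathbb{R}^d$ be measurable, and write $E_j:=T_K^jE_0$. If $E_1\subseteq E_0$, then $E_2=T_KE_1\subseteq E_1$ and $$\operatorname{dist}(E_2,\partial E_1)\ge\operatorname{dist}(E_1,\partial E_0).$$
   Context: A suitable convolution kernel is a function $K:\mathbb{R}^d\to\mathbb{R}$ with $K\ge 0$, $K(-x)=K(x)$, and $\int_{\mathbb{R}^d}K\,dx=1$. The thresholding operator is $T_KE:=\{x\in\mathbb{R}^d : (K*\chi_E)(x)>1/2\}$ for measurable $E$, and $T_K^j$ is its $j$-fold iterate. $\operatorname{dist}(A,B)=\inf\{|a-b|:a\in A,b\in B\}$, with $\inf\varnothing=+\infty$. *)

(* Defs.v *)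
From HB Require Import structures.
From mathcomp Require Import all_boot all_order all_algebra.
From mathcomp Require Import all_classical all_reals all_analysis.

Set Implicit Arguments.
Unset Strict Implicit.
Unset Printing Implicit Defensive.
Import Order.TTheory GRing.Theory Num.Theory.
Import numFieldNormedType.Exports.

Local Open Scope classical_set_scope.
Local Open Scope ring_scope.

(** Lebesgue measure on R^d: the outer measure induced by countable covers by
    half-open boxes, restricted to its Caratheodory sigma-algebra, i.e. to the
    Lebesgue measurable (not only Borel) sets. In dimension 1 the library's
    completed_lebesgue_measure is built in the same way. *)

Section lebesgue_outer_measure.
Context {R : realType} {d : nat}.
Implicit Types (p : 'rV[R]_d * 'rV[R]_d) (A : set 'rV[R]_d).

Definition box p : set 'rV[R]_d :=
  [set x | forall i, p.1 0 i < x 0 i <= p.2 0 i].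

Definition box_volume p : \bar R :=
  (\prod_(i < d) Num.max (p.2 0 i - p.1 0 i) 0)%:E.

(* Boxes are given by pairs of opposite corners. The covers range over countable
   sets of boxes rather than sequences because in dimension 0 no box is empty,
   so that no sequence of boxes would witness that set0 is null. *)
Definition lebesgue_outer A : \bar R :=
  ereal_inf [set (\esum_(p in D) box_volume p)%E | D in
    [set D : set ('rV[R]_d * 'rV[R]_d) |
      countable D /\ A `<=` \bigcup_(p in D) box p]].

Lemma box_volume_ge0 p : (0 <= box_volume p)%E.
Proof. by rewrite lee_fin prodr_ge0// => i _; rewrite le_max lexx orbT. Qed.

Lemma lebesgue_outer_ge0 A : (0 <= lebesgue_outer A)%E.
Proof.
apply: le_ereal_inf_tmp => _ [D _ <-].
by apply: esum_ge0 => p _; exact: box_volume_ge0.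
Qed.

Lemma lebesgue_outer0 : lebesgue_outer set0 = 0%E.
Proof.
apply/eqP; rewrite eq_le lebesgue_outer_ge0 andbT.
apply: ereal_inf_lbound; exists set0; last exact: esum_set0.
by split=> //; exact: sub0set.
Qed.

Lemma le_lebesgue_outer : {homo lebesgue_outer : A B / A `<=` B >-> (A <= B)%E}.
Proof.
move=> A B AB; apply: ereal_inf_le_tmp => _ [D [cD BD] <-].
by exists D => //; split=> //; exact: subset_trans BD.
Qed.

Lemma lebesgue_outer_sigma_subadditive : sigma_subadditive lebesgue_outer.
Proof.
move=> A; have [[i ioo]|] := pselect (exists i, lebesgue_outer (A i) = +oo%E).
  rewrite (eseries_pinfty _ _ ioo) ?leey// => n _.
  by rewrite -ltNye (lt_le_trans _ (lebesgue_outer_ge0 _)).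
rewrite -forallNE => Aoo; apply/lee_addgt0Pr => _/posnumP[e].
rewrite (le_trans _ (epsilon_trick _ _ _))//; last first.
  by move=> n; exact: lebesgue_outer_ge0.
pose P n (D : set ('rV[R]_d * 'rV[R]_d)) :=
  [/\ countable D, A n `<=` \bigcup_(p in D) box p &
    (\esum_(p in D) box_volume p <=
      lebesgue_outer (A n) + (e%:num / (2 ^ n.+1)%:R)%:E)%E].
have [D PD] : {D & forall n, P n (D n)}.
  apply: choice => n.
  have en1 : 0 < e%:num / (2 ^ n.+1)%:R by [].
  have fin : lebesgue_outer (A n) \is a fin_num.
    by rewrite ge0_fin_numE ?lebesgue_outer_ge0// ltey; apply/eqP; exact: Aoo.
  have [_ [D [cD AD] <-] /ltW Dle] := lb_ereal_inf_adherent en1 fin.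
  by exists D; split.
apply: (@le_trans _ _ (\esum_(p in \bigcup_n D n) box_volume p)%E).
  apply: ereal_inf_lbound; exists (\bigcup_n D n) => //; split.
    by apply: bigcup_countable => // n _; have [] := PD n.
  move=> x [n _ Anx]; have [_ /(_ _ Anx)[p Dp px] _] := PD n.
  by exists p => //; exists n.
rewrite seqDU_bigcup_eq esum_bigcupT; [|exact: trivIset_seqDU|exact: box_volume_ge0].
rewrite -nneseries_esumT; last first.
  by move=> n; apply: esum_ge0 => p _; exact: box_volume_ge0.
apply: lee_nneseries => [n _ _|n _].
  by apply: esum_ge0 => p _; exact: box_volume_ge0.
have [_ _] := PD n; apply: le_trans.
rewrite esum_mkcond [leRHS]esum_mkcond; apply: le_esum => p _.
case: ifPn => [pD|_]; last by case: ifPn => // _; exact: box_volume_ge0.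
by rewrite ifT// inE; apply: subset_seqDU; rewrite inE in pD.
Qed.

HB.instance Definition _ := isOuterMeasure.Build R 'rV[R]_d lebesgue_outer
  lebesgue_outer0 lebesgue_outer_ge0 le_lebesgue_outer
  lebesgue_outer_sigma_subadditive.

End lebesgue_outer_measure.

Arguments lebesgue_outer {R} d.

Definition lebesgue_outer_measure (R : realType) (d : nat) :
    {outer_measure set 'rV[R]_d -> \bar R} :=
  lebesgue_outer d.

Notation lebesgue_space R d := (caratheodory_type (lebesgue_outer_measure R d)).

Definition lebesgue_measure_rV (R : realType) (d : nat) :
    {measure set (lebesgue_space R d) -> \bar R} :=
  (lebesgue_outer_measure R d : set (lebesgue_space R d) -> \bar R).

Definition lebesgue_measurable (R : realType) (d : nat) (E : set 'rV[R]_d) :=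
  (lebesgue_outer_measure R d).-cara.-measurable E.

Record suitable_kernel (R : realType) (d : nat) (K : 'rV[R]_d -> R) : Prop := {
  kernel_measurable : measurable_fun setT (K : lebesgue_space R d -> R) ;
  kernel_ge0 : forall x, 0 <= K x ;
  kernel_even : forall x, K (- x) = K x ;
  kernel_integral : (\int[lebesgue_measure_rV R d]_x (K x)%:E = 1)%E }.

Definition convolution (R : realType) (d : nat) (f g : 'rV[R]_d -> R)
    (x : 'rV[R]_d) : \bar R :=
  (\int[lebesgue_measure_rV R d]_y (f (x - y) * g y)%:E)%E.

Definition threshold (R : realType) (d : nat) (K : 'rV[R]_d -> R)
    (E : set 'rV[R]_d) : set 'rV[R]_d :=
  [set x | ((2^-1)%:E < convolution K \1_E x)%E].

Definition boundary (T : topologicalType) (A : set T) : set T :=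
  closure A `\` interior A.

(* The norm of 'rV[R]_d in the library is the maximum norm. It induces the same
   topology, and so the same boundary, but not the same distance. *)
Definition euclidean_dist (R : realType) (d : nat) (x y : 'rV[R]_d) : R :=
  Num.sqrt (\sum_(i < d) (x 0 i - y 0 i) ^+ 2).

(* The infimum of the empty set is +oo in \bar R. *)
Definition set_dist (R : realType) (d : nat) (A B : set 'rV[R]_d) : \bar R :=
  ereal_inf [set (euclidean_dist a b)%:E | a in A & b in B].

(* Main.v *)
From HB Require Import structures.
Require Import Defs.
From mathcomp Require Import all_boot all_order all_algebra.
From mathcomp Require Import all_classical all_reals all_analysis.
Import Order.TTheory GRing.Theory Num.Theory.
Import numFieldNormedType.Exports.

Local Open Scope classical_set_scope.
Local Open Scope ring_scope.

(** Thresholding is monotone for inclusion ([threshold_monotone]) and commutes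
    with translations ([threshold_translate]). Monotonicity applied to
    E_1 `<=` E_0 gives E_2 `<=` E_1.

    For the distances, let delta be the distance from E_1 to the boundary of E_0.
    If |v| < delta, then E_1 + v `<=` E_0: a segment of length |v| that starts
    in E_1, hence in E_0, is too short to reach the boundary of E_0, and being
    connected it cannot leave E_0 without meeting that boundary
    ([mem_of_dist_lt_boundary]). Thresholding this inclusion gives
    E_2 + v `<=` E_1. So E_1 contains the open Euclidean ball of radius delta
    around each point of E_2, and no point of such a ball is on the boundary of
    E_1.

    Both properties of thresholding are used for E_1, which is itself the result
    of a thresholding. They are derived straight from the definition of the
    integral of a nonnegative function as a supremum over the simple functions
    below it, which makes sense for any integrand; this avoids the continuity of
    the convolution, through which one usually shows that E_1 is measurable.
    Translations enter through the outer measure: they permute the covers by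
    boxes, so they preserve the outer measure of every set, and hence the
    Caratheodory sigma-algebra as well. *)

(** * Integrals of arbitrary nonnegative functions *)

Section integral_of_any_function.
Local Open Scope ereal_scope.
Context d (T : measurableType d) (R : realType).
Context (mu : {measure set T -> \bar R}).
Implicit Types f g : T -> \bar R.

Import HBNNSimple.

(** A simple function below [f] is also below [g], so the supremum that defines
    the integral of [g] ranges over more functions. *)
Lemma ge0_le_integral_any f g :
  (forall x, 0 <= f x) -> (forall x, f x <= g x) ->
  \int[mu]_x f x <= \int[mu]_x g x.
Proof.
move=> f0 fg; have g0 x : 0 <= g x by exact: le_trans (fg x).
rewrite !ge0_integralTE//.
apply: ge_ereal_sup => _ [h hf <-]; apply: ereal_sup_ubound.
by exists h => // x; exact: le_trans (fg x).
Qed.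

(** If [h] is simple and below [f], then [h \o phi] is simple, below [f \o phi]
    and has the same integral as [h]. Only an inequality holds for arbitrary
    [f]: a simple function below [f \o phi] need not factor through [phi]. *)
Lemma le_integral_comp_preserving (phi : T -> T) f :
  measurable_fun setT phi ->
  (forall A, measurable A -> mu (phi @^-1` A) = mu A) ->
  (forall x, 0 <= f x) ->
  \int[mu]_x f x <= \int[mu]_x f (phi x).
Proof.
move=> mphi mu_phi f0; rewrite !ge0_integralTE//.
apply: ge_ereal_sup => _ [h hf <-]; apply: ereal_sup_ubound.
have finh : finite_set (range (h \o phi)).
  apply: (sub_finite_set _ (fimfunP h)) => _ [x _ <-].
  by exists (phi x).
have mh : measurable_fun setT (h \o phi) by exact: measurableT_comp.
have h0 x : (0 <= (h \o phi) x)%R by exact: fun_ge0.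
pose M := isMeasurableFun.Build _ _ _ _ _ mh.
pose F := FiniteImage.Build _ _ _ finh.
pose N := isNonNegFun.Build _ _ _ h0.
pose g : {nnsfun T >-> R} := HB.pack (h \o phi) M F N.
exists g; first by move=> x; exact: hf.
by apply: eq_fsbigr => r _; rewrite comp_preimage mu_phi.
Qed.

End integral_of_any_function.

(** * Translation invariance of Lebesgue measure *)

Section translation.
Context {R : realType} {d : nat}.
Implicit Types (v x y : 'rV[R]_d) (A : set 'rV[R]_d).

(** Translating the boxes of a cover of [A] by [- v] covers the preimage, with
    the same volumes. *)
Lemma le_lebesgue_outer_translate v A :
  (lebesgue_outer d (+%R^~ v @^-1` A) <= lebesgue_outer d A)%E.
Proof.
apply: le_ereal_inf_tmp => _ [D [cD AD] <-].
pose e (p : 'rV[R]_d * 'rV[R]_d) := (p.1 - v, p.2 - v).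
have inj_e : injective e by move=> [p q] [p' q'] [/addIr -> /addIr ->].
apply: ereal_inf_lbound; exists (e @` D).
  split; first exact: sub_countable (card_image_le _ _) cD.
  move=> x /AD[p Dp px]; exists (e p); first by exists p.
  move=> i; have := px i; rewrite !mxE.
  by rewrite ltrBlDr lerBrDr.
rewrite esum_image; last by move=> p q _ _; exact: inj_e.
apply: eq_esum => p _; rewrite /box_volume; congr (_%:E).
by apply: eq_bigr => i _ /=; rewrite !mxE opprB addrA subrK.
Qed.

Lemma lebesgue_outer_translate v A :
  lebesgue_outer d (+%R^~ v @^-1` A) = lebesgue_outer d A.
Proof.
apply/eqP; rewrite eq_le le_lebesgue_outer_translate/=.
have := le_lebesgue_outer_translate (- v) (+%R^~ v @^-1` A).
rewrite -comp_preimage.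
by rewrite (_ : _ \o _ = id)//; apply/funext => x /=; rewrite subrK.
Qed.

(** Translation invariance turns the Caratheodory criterion for the preimage of
    [A], tested on [X], into the criterion for [A], tested on a translate of
    [X]. *)
Lemma measurable_translate v :
  measurable_fun setT (+%R^~ v : lebesgue_space R d -> lebesgue_space R d).
Proof.
move=> _ A mA; rewrite setTI.
suff : (lebesgue_outer_measure R d).-caratheodory (+%R^~ v @^-1` A) by [].
move=> X.
have tX : X = +%R^~ v @^-1` (+%R^~ (- v) @^-1` X).
  by apply/seteqP; split => x /=; rewrite addrK.
rewrite tX preimage_setC -!preimage_setI /=.
have {}mA : (lebesgue_outer_measure R d).-caratheodory A := mA.
rewrite !lebesgue_outer_translate.
exact: etrans (esym (lebesgue_outer_translate (- v) X)) (mA _).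
Qed.

(** Translations are invertible, so the one-sided comparison for measure
    preserving maps can be applied in both directions. *)
Lemma integral_translate v (f : 'rV[R]_d -> \bar R) : (forall x, 0 <= f x)%E ->
  (\int[lebesgue_measure_rV R d]_x f (x + v)%R =
   \int[lebesgue_measure_rV R d]_x f x)%E.
Proof.
move=> f0.
have le u (g : 'rV[R]_d -> \bar R) : (forall x, 0 <= g x)%E ->
    (\int[lebesgue_measure_rV R d]_x g x <=
     \int[lebesgue_measure_rV R d]_x g (x + u)%R)%E.
  move=> g0.
  apply: (@le_integral_comp_preserving _ _ _ (lebesgue_measure_rV R d)
    (+%R^~ u : lebesgue_space R d -> lebesgue_space R d)) => //.
    exact: measurable_translate.
  by move=> A _; exact: lebesgue_outer_translate.
apply/eqP; rewrite eq_le le// andbT.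
apply: (le_trans (le (- v) _ _)); first by move=> x; exact: f0.
rewrite le_eqVlt; apply/orP; left; apply/eqP.
by apply: eq_integral => x _ /=; rewrite subrK.
Qed.

End translation.

(** * The thresholding operator *)

Section thresholding.
Context {R : realType} {d : nat} (K : 'rV[R]_d -> R) (K0 : forall x, 0 <= K x).
Implicit Types (v x : 'rV[R]_d) (A B : set 'rV[R]_d).

Lemma threshold_monotone A B : A `<=` B -> threshold K A `<=` threshold K B.
Proof.
move=> AB x /lt_le_trans; apply.
apply: ge0_le_integral_any => y.
  by rewrite lee_fin mulr_ge0// indicE.
rewrite lee_fin ler_wpM2l// !indicE ler_nat.
by case: (boolP (y \in A)) => // /set_mem/AB/mem_set ->.
Qed.

Lemma threshold_translate v A :
  threshold K (+%R^~ v @^-1` A) = +%R^~ v @^-1` threshold K A.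
Proof.
(* The substitution y |-> y + v carries one convolution integral to the other. *)
suff conv x : convolution K \1_(+%R^~ v @^-1` A) x = convolution K \1_A (x + v).
  by apply/seteqP; split=> x; rewrite /threshold/= conv.
rewrite /convolution.
rewrite -(integral_translate v (fun y => (K (x + v - y) * \1_A y)%:E)).
  apply: eq_integral => y _; rewrite opprD addrACA subrr addr0.
  by rewrite !indicE.
by move=> y; rewrite lee_fin mulr_ge0// indicE.
Qed.

End thresholding.

(** * Euclidean distance and boundaries *)

Section euclidean.
Context {R : realType} {d : nat}.
Implicit Types (x y z : 'rV[R]_d) (A B : set 'rV[R]_d).

Lemma euclidean_dist_segment (t : R) x y : 0 <= t ->
  euclidean_dist x (x + t *: (y - x)) = t * euclidean_dist x y.
Proof.
move=> t0; rewrite /euclidean_dist -{2}(ger0_norm t0) -sqrtr_sqr.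
rewrite -sqrtrM ?sqr_ge0// mulr_sumr; congr Num.sqrt; apply: eq_bigr => i _.
by rewrite !mxE opprD addrA subrr sub0r -mulrN opprB exprMn.
Qed.

Lemma euclidean_dist_translate x y z :
  euclidean_dist x (x + (z - y)) = euclidean_dist y z.
Proof.
rewrite /euclidean_dist; congr Num.sqrt; apply: eq_bigr => i _.
by rewrite !mxE opprD addrA subrr sub0r opprB.
Qed.

Lemma euclidean_dist_continuous x : continuous (euclidean_dist x).
Proof.
move=> y; apply: (@continuous_comp _ _ _
  (fun y : 'rV[R]_d => \sum_(i < d) (x 0 i - y 0 i) ^+ 2) Num.sqrt); last first.
  exact: sqrt_continuous.
apply: continuous_big => [|i _ z]; first exact: add_continuous.
apply: (@continuous_comp _ _ _ (fun y : 'rV[R]_d => x 0 i - y 0 i)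
  (fun r => r ^+ 2)); last exact: exprn_continuous.
by apply: continuousB; [exact: cst_continuous|exact: coord_continuous].
Qed.

(** Off the boundary of [A], the closure and the interior of [A] agree, so if [C]
    misses that boundary then [C `&` A] is both open and closed in [C]. *)
Lemma connected_sub_of_boundary0 (T : topologicalType) (C A : set T) :
  connected C -> C `&` A !=set0 -> C `&` boundary A = set0 -> C `<=` A.
Proof.
move=> cC [x [Cx Ax]] CA0.
have clint : C `&` closure A = C `&` interior A.
  apply/seteqP; split=> y [Cy Ay]; split => //; last first.
    by apply: subset_closure; exact: interior_subset.
  by apply: contrapT => nAy; have : (C `&` boundary A) y by []; rewrite CA0.
rewrite -(cC (C `&` interior A)).
- by move=> y [_ /interior_subset].
- by exists x; rewrite -clint; split=> //; exact: subset_closure.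
- by exists (interior A) => //; exact: open_interior.
- by exists (closure A) => //; exact: closed_closure.
Qed.

(** The segment from [x] to [y] is connected, and its points are no farther from
    [x] than [y] is, so it misses the boundary of [B]. *)
Lemma mem_of_dist_lt_boundary A B x y :
  A `<=` B -> A x ->
  ((euclidean_dist x y)%:E < set_dist A (boundary B))%E -> B y.
Proof.
move=> AB Ax xy.
pose g (t : R) := x + t *: (y - x).
have cg : connected (g @` `[0, 1]).
  apply: connected_continuous_connected; first exact: segment_connected.
  apply: continuous_subspaceT => t.
  by apply: (@cvgD R 'rV[R]_d); [exact: cvg_cst|exact: scalel_continuous].
apply: (connected_sub_of_boundary0 _ _ _ cg).
- exists x; split; last exact: AB.
  by exists 0; rewrite /g/= ?scale0r ?addr0// in_itv/= lexx ler01.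
- rewrite -subset0 => _ [[t t01 <-] bt].
  move: t01; rewrite /= in_itv/= => /andP[t0 t1].
  have : (set_dist A (boundary B) <= (euclidean_dist x (g t))%:E)%E.
    by apply: ereal_inf_lbound; exists x => //; exists (g t).
  apply/negP; rewrite -ltNge; apply: le_lt_trans xy.
  by rewrite lee_fin euclidean_dist_segment// ler_piMl// sqrtr_ge0.
- by exists 1; rewrite /g/= ?scale1r ?(addrC x) ?subrK// in_itv/= lexx ler01.
Qed.

End euclidean.

Theorem theorem3p1 (R : realType) (d : nat) (K : 'rV[R]_d -> R)
    (E0 : set 'rV[R]_d) :
  suitable_kernel K -> lebesgue_measurable E0 ->
  let E := fun j : nat => iter j (threshold K) E0 in
  E 1%N `<=` E 0%N ->
  E 2%N `<=` E 1%N /\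
  (set_dist (E 1%N) (boundary (E 0%N)) <=
   set_dist (E 2%N) (boundary (E 1%N)))%E.
Proof.
move=> [_ K0 _ _] _ E E10; split; first exact: threshold_monotone.
apply: le_ereal_inf_tmp => _ [a E2a [b [_ bE1] <-]].
(* If b were closer to a than the claimed bound, it would be interior to E 1. *)
rewrite leNgt; apply/negP => ab; apply: bE1.
pose U := [set r : R | (r%:E < set_dist (E 1%N) (boundary (E 0%N)))%E].
have : \forall y \near b, U (euclidean_dist a y).
  apply: (euclidean_dist_continuous a b).
  by apply: open_nbhs_nbhs; split; first exact: open_ereal_lt.
apply: filterS => y Uy.
have sub : E 1%N `<=` +%R^~ (y - a) @^-1` E 0%N.
  move=> x E1x; apply: (mem_of_dist_lt_boundary _ _ x _ E10) => //.
  by rewrite euclidean_dist_translate.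
(* Thresholding the inclusion of E 1 in a translate of E 0 gives the inclusion
   of E 2 in the same translate of E 1, which is then read at the point a. *)
have := threshold_monotone K K0 _ _ sub _ E2a.
by rewrite threshold_translate//= addrC subrK.
Qed.
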